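(* There exists a tall ideal $\mathcal{I}$ on $\omega$ which is Ramsey but not Galvin.
   Context: An ideal on $\omega$ is a family $\mathcal{I}\subseteq\wp(\omega)$ containing all finite sets, with $\omega\notin\mathcal{I}$, closed under subsets and finite unions. $\mathcal{I}^+$ is the family of infinite subsets of $\omega$ not in $\mathcal{I}$. $[X]^{\omega}$, $[X]^{<\omega}$ and $[X]^2$ denote the families of infinite, finite, and two-element subsets of $X$. $\mathcal{I}$ is tall if every $A\in\mathcal{I}^+$ contains an infinite subset belonging to $\mathcal{I}$. $\mathcal{I}$ is Ramsey if for every $A\in\mathcal{I}^+$ and every $\pi:[A]^2\to 2$ there is $H\in\mathcal{I}^+$, $H\subseteq A$, such that $\pi$ is constant on $[H]^2$. For finite $s\subseteq\omega$ and infinite $C\subseteq\omega$, $s\sqsubset C$ means that $s$ is an initial segment of $C$ in its increasing enumeration. For $\mathcal{F}\subseteq[\omega]^{<\omega}$, $\mathrm{hom}(\mathcal{F})$ is the collection of all $B\in[\omega]^\omega$ such that either (I) for every $C\in[B]^\omega$ there is $s\in\mathcal{F}$ with $s\sqsubset C$, or (II) $[B]^{<\omega}\cap\mathcal{F}=\emptyset$. $\mathcal{I}$ is Galvin if for every $\mathcal{F}\subseteq[\omega]^{<\omega}$ and every $A\in\mathcal{I}^+$ there is $B\in\mathcal{I}^+$, $B\subseteq A$, with $B\in\mathrm{hom}(\mathcal{F})$. *)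

(* Defs.v *)
From mathcomp Require Import all_boot all_order.
From mathcomp Require Import boolp classical_sets functions cardinality.

Set Implicit Arguments.
Unset Strict Implicit.
Unset Printing Implicit Defensive.

Local Open Scope classical_set_scope.
Local Open Scope card_scope.

Definition infinite_subsets (X : set nat) : set (set nat) :=
  [set B | B `<=` X /\ infinite_set B].

Definition finite_subsets (X : set nat) : set (set nat) :=
  [set s | s `<=` X /\ finite_set s].

Definition two_subsets (X : set nat) : set (set nat) :=
  [set s | s `<=` X /\ s #= `I_2].

Definition is_ideal (I : set (set nat)) : Prop :=
  [/\ forall A, finite_set A -> I A,
      ~ I [set: nat],
      forall A B, A `<=` B -> I B -> I A
    & forall A B, I A -> I B -> I (A `|` B)].

Definition positive (I : set (set nat)) : set (set nat) :=
  [set A | infinite_set A /\ ~ I A].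

Definition tall (I : set (set nat)) : Prop :=
  forall A, positive I A -> exists2 B, infinite_subsets A B & I B.

(* A colouring of the two-element subsets of [A] is a total function on
   [set nat] of which only the values on [two_subsets A] are used. *)
Definition ramsey (I : set (set nat)) : Prop :=
  forall (A : set nat) (c : set nat -> bool), positive I A ->
    exists H, [/\ positive I H, H `<=` A
      & exists b, forall s, two_subsets H s -> c s = b].

Definition initial_segment (s C : set nat) : Prop :=
  s `<=` C /\ forall m n, s n -> C m -> (m < n)%N -> s m.

Definition hom (F : set (set nat)) : set (set nat) :=
  [set B | infinite_set B /\
     ((forall C, infinite_subsets B C ->
         exists2 s, F s & initial_segment s C) \/
      finite_subsets B `&` F = set0)].

Definition galvin (I : set (set nat)) : Prop :=
  forall (F : set (set nat)) (A : set nat),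
    F `<=` finite_subsets [set: nat] -> positive I A ->
    exists B, [/\ positive I B, B `<=` A & hom F B].

(* Main.v *)
Require Import Defs.
From mathcomp Require Import all_boot all_order.
From mathcomp Require Import boolp classical_sets functions cardinality.
From mathcomp Require Import filter zify.

(** Finite subsets of [nat] are written as increasing lists, so a two-colouring
    of them is a function [D : seq nat -> bool].  Take [D] generic: all finite
    patterns [t |-> D (rcons t y)] occur for arbitrarily large [y]
    ([generic_exists]).  Let [F] be the family of the sets [s] of size
    [min s + 1] with [D s = true].  It contains sets of unbounded size, and
    this is the whole point: one application of the partition property for
    pairs can lower the number of variables on which [D] depends by one, but no
    finite number of applications can make [F] homogeneous.

    Precisely, call [A] [k]-shifted if, beyond some number, the colour of an
    increasing list in [A] does not depend on its last [k] entries, and is a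
    generic function of the rest.  The heart of the matter is
    [generic_homogeneous], by which, for every colouring of pairs, a [k]-shifted
    set has a homogeneous [k.+1]-shifted subset ([shifted_homogeneous]).  Let
    the ideal consist of the sets that contain no shifted set, for any [k].

    - It is an ideal, and Ramsey, because of that one fact: a partition of a
      shifted set into two pieces is the special case in which the colour of a
      pair depends on its minimum ([shift_ideal_is_ideal],
      [shift_ideal_ramsey]).
    - It is not Galvin: on a [k]-shifted set the genericity, applied to lists
      whose least entry [n] exceeds [k], gives lists of length [n + 1] of both
      colours ([shifted_two_colours]), so no positive set is homogeneous for [F]
      ([shift_ideal_not_galvin]).
    - It is tall: iterated limits of [D] along an ultrafilter that contains [A]
      give an infinite [B] in [A] on which the colour of a list of size
      [min + 1] depends on its minimum only ([tame_subset]), and by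
      [shifted_two_colours] no subset of [B] is shifted.

    For [generic_homogeneous], let [E] be generic on [A] and [c] a colouring of
    pairs.  A fusion argument constructs limits [E'] of [E (rcons t y)] and [d]
    of [c x y] as [y] varies, along a set on which [E'] is again generic
    ([generic_limit]).  Genericity is indivisible: one of the classes of [d],
    cut down to the points of a fixed finite pattern, still realises everything.
    A sequence of points of this class that converges fast enough is the
    required homogeneous set. *)

Set Implicit Arguments.
Unset Strict Implicit.
Unset Printing Implicit Defensive.

Local Open Scope classical_set_scope.

(** * Increasing lists and a universal sequence of labellings *)

(** The empty list is excluded because a pattern on it would colour single
    points, and such a colouring can be made constant by a colouring of pairs. *)
Definition incr_in (lo hi : nat) (t : seq nat) : bool :=
  [&& t != [::], sorted ltn t & all (fun x => lo <= x < hi) t].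

Lemma incr_in_widen lo lo' hi hi' t :
  lo' <= lo -> hi <= hi' -> incr_in lo hi t -> incr_in lo' hi' t.
Proof.
move=> lolo hihi /and3P[t0 st /allP tin]; apply/and3P; split=> //.
by apply/allP => x /tin; lia.
Qed.

Lemma sorted_rcons_ltn t y :
  sorted ltn (rcons t y) = sorted ltn t && all (fun x => x < y) t.
Proof.
elim: t => [|x t IH] //=.
rewrite !(path_sortedE ltn_trans) all_rcons IH /=.
have [xy|xy] := boolP (x < y); rewrite ?andbF //=.
by rewrite andbA.
Qed.

Lemma incr_in_rcons lo hi t y :
  incr_in lo hi (rcons t y) =
  [&& sorted ltn t, all (fun x => lo <= x < y) t & lo <= y < hi].
Proof.
rewrite /incr_in sorted_rcons_ltn all_rcons -size_eq0 size_rcons /=.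
apply/idP/idP.
  case/andP => /andP[st /allP lt] /andP[-> /allP rg]; rewrite st andbT.
  by apply/allP => x xt; have := lt x xt; have := rg x xt; lia.
case/and3P => -> /allP rg yy; rewrite yy /=.
by apply/andP; split; apply/allP => x xt; have := rg x xt; lia.
Qed.

Lemma incr_in_snoc lo y t : incr_in lo y t -> lo <= y -> incr_in lo y.+1 (rcons t y).
Proof. by case/and3P => _ st rg ly; rewrite incr_in_rcons st rg /=; lia. Qed.

Lemma incr_in_last lo hi t : incr_in lo hi t -> incr_in lo (last 0 t).+1 t.
Proof.
case/lastP: t => [|t y]; first by case/and3P.
by rewrite last_rcons !incr_in_rcons leqnn => /and3P[-> -> /andP[-> _]].
Qed.

Lemma sorted_below_enum hi :
  exists ss : seq (seq nat), forall t,
    sorted ltn t -> all (fun x => x < hi) t -> t \in ss.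
Proof.
exists [seq mask (tval m) (iota 0 hi) | m <- enum {: hi.-tuple bool}].
move=> t st /allP lt.
have -> : t = [seq x <- iota 0 hi | x \in t].
  apply: (irr_sorted_eq ltn_trans ltnn) => //.
    by apply: sorted_filter; [exact: ltn_trans | exact: iota_ltn_sorted].
  by move=> x; rewrite mem_filter mem_iota; case: (boolP (x \in t)) => // /lt ->.
rewrite filter_mask.
have sz : size [seq x \in t | x <- iota 0 hi] == hi by rewrite size_map size_iota.
by apply/mapP; exists (Tuple sz) => //; rewrite mem_enum.
Qed.

(** The sequence [s] serves as bookkeeping: a generic colouring or generic set
    that is built so as to obey [s i] at stage [i] meets each finite requirement
    at arbitrarily late stages. *)
Lemma universal_labels : exists s : nat -> seq nat -> bool,
  forall hi (lam : seq nat -> bool) n, exists2 i, n <= i &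
    forall t, incr_in 0 hi t -> s i t = lam t.
Proof.
(* The factor [3 ^ n] makes the index large without changing what it codes. *)
exists (fun i t => t \in odflt [::] (unpickle (logn 2 i) : option (seq (seq nat)))).
move=> hi lam n; have [ss ssP] := sorted_below_enum hi.
exists (2 ^ pickle [seq t <- ss | lam t] * 3 ^ n).
  apply: leq_trans (_ : 3 ^ n <= _); first exact/ltnW/ltn_expl.
  by rewrite leq_pmull // expn_gt0.
move=> t /and3P[_ st rg].
rewrite lognM ?expn_gt0 // pfactorK // lognX (logn_coprime (m := 3)) // muln0 addn0.
by rewrite pickleK /= mem_filter ssP ?andbT.
Qed.

(** * Generic colourings *)

(** The bound [lo] lets a generic set lose control over the labels of lists that
    start below [lo]; this is the price of fixing a finite pattern in the proof
    of [generic_homogeneous]. *)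
Definition generic (A : set nat) (lo : nat) (E : seq nat -> bool) : Prop :=
  forall hi (lam : seq nat -> bool), exists y,
    [/\ A y, hi <= y & forall t, incr_in lo hi t -> E (rcons t y) = lam t].

Lemma generic_exists : exists D, generic [set: nat] 0 D.
Proof.
have [s sP] := universal_labels.
exists (fun u => s (last 0 u) (take (size u).-1 u)) => hi lam.
have [y hy yP] := sP hi lam hi.
exists y; split=> // t gt.
by rewrite last_rcons size_rcons /= -cats1 take_size_cat // yP.
Qed.

(** * Limits of generic colourings *)
Section Limit.
Variables (A : set nat) (lo : nat) (E : seq nat -> bool).
Variable c : nat -> nat -> bool.

(** A finite approximation to the two limits: [e] on lists below [N] and [d] on
    points below [M].  The points of [A] that agree with it are required to
    realise all further patterns, so that they form a somewhere dense set in the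
    space of patterns. *)
Definition dense N M (e : seq nat -> bool) (d : nat -> bool) : Prop :=
  forall N' (e' : seq nat -> bool), N <= N' ->
    (forall t, incr_in lo N t -> e' t = e t) ->
    exists y, [/\ A y, N' <= y,
      forall t, incr_in lo N' t -> E (rcons t y) = e' t
    & forall x, x < M -> c x y = d x].

Lemma dense_widen N N' M e e' d : N <= N' ->
  (forall t, incr_in lo N t -> e' t = e t) -> dense N M e d -> dense N' M e' d.
Proof.
move=> NN ee dn N'' e'' NN' ee'; apply: dn; first by lia.
by move=> t gt; rewrite ee' ?ee //; apply: incr_in_widen gt.
Qed.

(** Somewhere dense sets are indivisible: if the points [y] with [c M y = false]
    fail to be dense, a pattern [e'] on a longer interval avoids them, and beyond
    [e'] all points have [c M y = true]. *)
Lemma dense_colour N M e d : dense N M e d ->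
  exists N' e' d', [/\ dense N' M.+1 e' d', N <= N',
    forall t, incr_in lo N t -> e' t = e t & forall x, x < M -> d' x = d x].
Proof.
move=> dn.
pose upd b x := if x == M then b else d x.
have updE b x : x < M -> upd b x = d x by rewrite /upd; case: eqP => //; lia.
have [dn0|] := pselect (dense N M.+1 e (upd false)).
  by exists N, e, (upd false); split=> // x /(updE false).
move=> /existsNP[N' /existsNP[e' /not_implyP[NN /not_implyP[ee no]]]].
exists N', e', (upd true); split=> // [N'' e'' NN' ee'|x /(updE true) //].
have [y [Ay hy yE yc]] : exists y, [/\ A y, N'' <= y,
      forall t, incr_in lo N'' t -> E (rcons t y) = e'' t
    & forall x, x < M -> c x y = d x].
  by apply: (dense_widen NN ee dn).
exists y; split=> // x; rewrite ltnS leq_eqVlt => /predU1P[->|xM]; last first.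
  by rewrite updE ?yc.
rewrite /upd eqxx; apply: contra_notT no => cF; exists y; split=> //.
- by lia.
- by move=> t gt; rewrite yE ?ee' //; apply: incr_in_widen gt.
move=> z; rewrite ltnS leq_eqVlt => /predU1P[->|zM]; last by rewrite updE ?yc.
by rewrite /upd eqxx; apply: negbTE.
Qed.

(** The labels [e'] of the lists ending in the new point [y] are free, since the
    approximation [e] speaks only of lists below [N <= y].  This freedom is what
    makes the limit generic. *)
Lemma dense_step N M e d (lam : seq nat -> bool) : dense N M e d -> M <= N ->
  exists N' e' d', [/\ [/\ dense N' M.+1 e' d', M.+1 <= N' & N <= N'],
    forall t, incr_in lo N t -> e' t = e t, forall x, x < M -> d' x = d x
  & exists y, [/\ A y, N <= y, y < N',
      forall t, incr_in lo N t -> E (rcons t y) = e t /\ e' (rcons t y) = lam t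
    & forall x, x < M -> c x y = d x]].
Proof.
move=> dn MN; have [y [Ay hy yE yc]] := dn N e (leqnn N) (fun t _ => erefl).
(* [e1] does not mention [y]: every list outside the old domain receives the
   label that [lam] gives to the list without its last entry. *)
pose e1 u := if incr_in lo N u then e u else lam (take (size u).-1 u).
have e1E t : incr_in lo N t -> e1 t = e t by rewrite /e1 => ->.
have Ny : N <= y.+1 by lia.
have [N' [e' [d' [dn' yN' ee dd]]]] := dense_colour (dense_widen Ny e1E dn).
exists N', e', d'; split=> //.
- by split=> //; lia.
- by move=> t gt; rewrite ee ?e1E //; apply: incr_in_widen gt.
exists y; split=> // t gt; split; first exact: yE.
have gt1 : incr_in lo y.+1 (rcons t y).
  apply: incr_in_snoc; first by apply: incr_in_widen gt.
  by case/and3P: gt; case: t => //= x t _ _ /andP[]; lia.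
rewrite ee // /e1 incr_in_rcons [lo <= y < N]andbC ltnNge hy /= !andbF.
by rewrite size_rcons /= -cats1 take_size_cat.
Qed.

(** The union of a chain of approximations, stage [i] of which obeys
    [dense_step] for the labelling [s i]. *)
Lemma generic_limit : generic A lo E -> exists E' (d : nat -> bool),
  forall hi (lam : seq nat -> bool), exists y, [/\ A y, hi <= y,
    forall t, incr_in lo hi t -> E (rcons t y) = E' t /\ E' (rcons t y) = lam t
  & forall x, x < hi -> c x y = d x].
Proof.
move=> gE; have [s sP] := universal_labels.
pose cond := (nat * (seq nat -> bool) * (nat -> bool))%type.
pose ok M (q : cond) := dense q.1.1 M q.1.2 q.2 /\ M <= q.1.1.
pose next M (q q' : cond) := [/\ q.1.1 <= q'.1.1,
    forall t, incr_in lo q.1.1 t -> q'.1.2 t = q.1.2 t,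
    forall x, x < M -> q'.2 x = q.2 x
  & exists y, [/\ A y, q.1.1 <= y, y < q'.1.1,
      forall t, incr_in lo q.1.1 t ->
        E (rcons t y) = q.1.2 t /\ q'.1.2 (rcons t y) = s M t
    & forall x, x < M -> c x y = q.2 x]].
have /choice[f fP] (p : nat * cond) :
    exists q', ok p.1 p.2 -> ok p.1.+1 q' /\ next p.1 p.2 q'.
  have [[dn MN]|nok] := pselect (ok p.1 p.2); last by exists p.2 => /nok.
  have [N' [e' [d' [[dn' MN' NN] ee dd ex]]]] := dense_step (s p.1) dn MN.
  by exists (N', e', d') => _.
pose fix q i : cond :=
  if i is j.+1 then f (j, q j) else (0, fun=> false, fun=> false).
have qok i : ok i (q i).
  elim: i => [|i IH] /=; last by have [] := fP (i, q i) IH.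
  split=> // N' e' _ _; have [y [Ay hy yE]] := gE N' e'.
  by exists y.
have qn i : next i (q i) (q i.+1) by have [] := fP (i, q i) (qok i).
have qN i j : i <= j -> [/\ (q i).1.1 <= (q j).1.1,
    forall t, incr_in lo (q i).1.1 t -> (q j).1.2 t = (q i).1.2 t
  & forall x, x < i -> (q j).2 x = (q i).2 x].
  move=> ij; rewrite -(subnKC ij); elim: (j - i) => [|k [IN Ie Id]].
    by rewrite addn0.
  have [nN ne nd _] := qn (i + k); rewrite addnS; split.
  - exact: leq_trans nN.
  - by move=> t gt; rewrite ne ?Ie //; apply: incr_in_widen gt.
  - by move=> x xi; rewrite nd ?Id //; lia.
have qle i : i <= (q i).1.1 by have [] := qok i.
(* Stage [i] decides lists below [i], so the last entry of a list tells a
   stage at which its label is final. *)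
pose E' t := (q (last 0 t).+1).1.2 t.
have E'E i t : incr_in lo (q i).1.1 t -> E' t = (q i).1.2 t.
  move=> gt; rewrite /E'; set j := (last 0 t).+1.
  have [ij|/ltnW ji] := leqP i j; first by have [_ ->] := qN _ _ ij.
  have [_ -> //] := qN _ _ ji.
  exact: incr_in_widen (leqnn _) (qle j) (incr_in_last gt).
pose d x := (q x.+1).2 x.
have dE i x : x < i -> (q i).2 x = d x by move=> xi; have [_ _ ->] := qN _ _ xi.
exists E', d => hi lam; have [i hi_i iP] := sP hi lam hi.
have [_ _ _ [y [Ay qy yq yE yc]]] := qn i.
have hiq := leq_trans hi_i (qle i).
exists y; split=> //; first exact: leq_trans qy.
  move=> t gt; have gtq := incr_in_widen (leqnn _) hiq gt.
  have [eE eE'] := yE t gtq; split; first by rewrite eE -E'E.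
  rewrite (E'E i.+1) ?eE' ?iP //; first by apply: incr_in_widen gt.
  apply: incr_in_widen (leqnn _) yq _; apply: incr_in_snoc.
    by apply: incr_in_widen gtq.
  by case/and3P: gt; case: (t) => //= x ? _ _ /andP[]; lia.
by move=> x xh; rewrite yc ?dE //; lia.
Qed.

End Limit.

(** * Homogeneous generic subsets *)

(** The bound [m] exceeds all earlier values, so that [P i m] can ask the new
    value to suit every finite set formed by the earlier ones. *)
Lemma increasing_choice (P : nat -> nat -> nat -> Prop) :
  (forall i m, exists2 y, m <= y & P i m y) ->
  exists g : nat -> nat, {homo g : i j / i < j} /\
    forall i, exists m, [/\ i <= m, forall l, l < i -> g l < m & P i m (g i)].
Proof.
move=> ex; have /choice[f fP] (p : nat * nat) : exists y, p.2 <= y /\ P p.1 p.2 y.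
  by have [y] := ex p.1 p.2; exists y.
pose fix g i := f (i, if i is j.+1 then (g j).+1 else 0).
have gS i : g i < g i.+1 by have [] := fP (i.+1, (g i).+1).
have gmono : {homo g : i j / i < j} by apply: homo_ltn => //; exact: ltn_trans.
have gi i : i <= g i by elim: i => // i IH; exact: leq_ltn_trans IH (gS i).
exists g; split=> // i; exists (if i is j.+1 then (g j).+1 else 0); split.
- by case: i => // j; exact: gi.
- case: i => // j l; rewrite !ltnS leq_eqVlt => /predU1P[->//|/gmono].
  exact: ltnW.
- case: i => [|j]; first by have [] := fP (0, 0).
  by have [] := fP (j.+1, (g j).+1).
Qed.

(** After [generic_limit], a set of points is homogeneous as soon as [d] is
    constant on it and each point is chosen late enough.  A generic set of
    points with [d = b] exists by indivisibility: either the points with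
    [d = false] realise everything, or some finite pattern [lam0] forces
    [d = true].  In the latter case the new set is taken above the domain of
    [lam0], so that its own patterns remain free. *)
Lemma generic_homogeneous A lo E (c : nat -> nat -> bool) : generic A lo E ->
  exists B lo' E' b, [/\ B `<=` A, lo <= lo', generic B lo' E',
    forall x y, B x -> B y -> x < y -> c x y = b
  & forall t y, incr_in lo' y t -> (forall x, x \in t -> B x) -> B y ->
      E (rcons t y) = E' t].
Proof.
move=> /(generic_limit c)[E' [d lim]].
pose lim_at hi lam y := [/\ A y, hi <= y,
    forall t, incr_in lo hi t -> E (rcons t y) = E' t /\ E' (rcons t y) = lam t
  & forall x, x < hi -> c x y = d x].
have [b [lo' [lam0 [lolo' rich]]]] : exists b lo' lam0, lo <= lo' /\
    forall hi lam, lo' <= hi -> (forall t, incr_in lo lo' t -> lam t = lam0 t) ->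
      exists2 y, lim_at hi lam y & d y = b.
  have [all0|] := pselect (forall hi lam, exists2 y, lim_at hi lam y & d y = false).
    by exists false, lo, (fun=> false).
  move=> /existsNP[N /existsNP[lam0 no]].
  exists true, (maxn lo N), lam0; split; first by rewrite leq_maxl.
  move=> hi lam hhi agree; have [y lim_y] := lim hi lam.
  exists y => //; apply: contra_notT no => /negbTE dy; exists y => //.
  have [Ay hy yE yc] := lim_y; split=> //.
  - by lia.
  - move=> t gt; have [|-> ->] := yE t; first by apply: incr_in_widen gt; lia.
    by rewrite agree //; apply: incr_in_widen gt; lia.
  - by move=> x xN; apply: yc; lia.
have [s sP] := universal_labels.
(* The fixed pattern [lam0] on lists below [lo'], and the bookkeeping on all
   others, in particular on the nonempty lists of points above [lo']. *)
pose lam i t := if incr_in lo lo' t then lam0 t else s i t.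
pose P i m y := exists hi,
  [/\ m <= hi, i <= hi, lo' <= hi, lim_at hi (lam i) y & d y = b].
have /increasing_choice[g [gmono gP]] i m : exists2 y, m <= y & P i m y.
  pose hi := maxn (maxn m i) lo'.
  have [||y lim_y dy] := rich hi (lam i); first by lia.
    by move=> t gt; rewrite /lam gt.
  exists y; last by exists hi; split=> //; lia.
  by have [_ hy _ _] := lim_y; lia.
have gind i j : g i < g j -> i < j.
  by rewrite (leqW_mono (leq_mono gmono)).
exists (range g), lo', E', b; split=> //.
- by move=> _ [i _ <-]; have [m [_ _ [hi [_ _ _ [] ]]]] := gP i.
- move=> hi mu; have [i hi_i iP] := sP hi mu hi.
  have [m [_ _ [hi' [_ ii' lohi' [_ hy yE _] _]]]] := gP i.
  exists (g i); split; [by exists i | by lia |] => t gt.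
  have [|_ ->] := yE t; first by apply: incr_in_widen gt; lia.
  rewrite /lam ifF ?iP //; first by apply: incr_in_widen gt.
  by case/and3P: gt; case: t => //= x t _ _ /andP[+ _]; rewrite /incr_in /=; lia.
- move=> _ _ [i _ <-] [j _ <-] /gind ij.
  have [_ [_ _ [_ [_ _ _ _ di]]]] := gP i.
  have [m [_ lm [hi [mhi _ _ [_ _ _ jc] _]]]] := gP j.
  by rewrite jc //; apply: leq_trans mhi; apply: lm.
- move=> t y gt tB [j _ yj]; subst y.
  have [m [_ lm [hi [mhi _ lohi [_ _ yE _] _]]]] := gP j.
  have [|-> //] := yE t.
  case/and3P: gt => t0 st /allP rg; apply/and3P; split=> //; apply/allP => x xt.
  have [i _ gi] := tB x xt; have := rg x xt; rewrite -gi.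
  by move=> /andP[lx /gind/lm]; lia.
Qed.

(** * Shifted sets *)
Definition shifted (D : seq nat -> bool) (k : nat) (A : set nat) : Prop :=
  exists lo E, generic A lo E /\
    forall t ys, t != [::] -> sorted ltn (t ++ ys) ->
      (forall x, x \in t ++ ys -> A x /\ lo <= x) -> size ys = k ->
      D (t ++ ys) = E t.

Lemma generic_unbounded A lo E : generic A lo E -> forall n, exists2 y, n <= y & A y.
Proof. by move=> gE n; have [y [Ay ny _]] := gE n xpredT; exists y. Qed.

Lemma shifted_homogeneous D k A (c : nat -> nat -> bool) : shifted D k A ->
  exists B b, [/\ shifted D k.+1 B, B `<=` A
    & forall x y, B x -> B y -> x < y -> c x y = b].
Proof.
move=> [lo [E [/(generic_homogeneous c)[B [lo' [E' [b [BA lolo gE' hom EE']]]]] DE]]].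
exists B, b; split=> //; exists lo', E'; split=> // t [//|y ys] t0.
rewrite -cat_rcons => st inB [sz].
rewrite DE //; last 2 first.
- by rewrite -size_eq0 size_rcons.
- by move=> x /inB[/BA Ax lx]; split=> //; exact: leq_trans lx.
apply: EE'.
- move: st => /cat_sorted2[+ _]; rewrite sorted_rcons_ltn => /andP[st /allP lt].
  apply/and3P; split=> //; apply/allP => x xt; rewrite lt // andbT.
  by have [|_ ->] := inB x; rewrite // mem_cat mem_rcons inE xt orbT.
- by move=> x xt; have [] := inB x; rewrite // mem_cat mem_rcons inE xt orbT.
- by have [] := inB y; rewrite // mem_cat mem_rcons inE eqxx.
Qed.

Lemma unbounded_path A m n : (forall n, exists2 y, n <= y & A y) ->
  exists u, [/\ size u = m, path ltn n u & forall x, x \in u -> A x].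
Proof.
move=> unb; elim: m n => [|m IH] n; first by exists [::].
have [y ny Ay] := unb n.+1; have [u [sz pu uA]] := IH y.
exists (y :: u); split=> /=; [by rewrite sz | by rewrite ny |].
by move=> x; rewrite inE => /predU1P[->|/uA].
Qed.

(** Choose [n > k] and lists [n :: v] of length [n - k].  Genericity prescribes
    the colour through the next entry [y], and the last [k] entries have no
    influence.  The point [n] is the same for both colours: both
    [shift_ideal_tall] and [shift_ideal_not_galvin] depend on this. *)
Lemma shifted_two_colours D k A : shifted D k A ->
  exists n, forall b, exists u, [/\ size u = n, path ltn n u,
    forall x, x \in n :: u -> A x & D (n :: u) = b].
Proof.
move=> [lo [E [gE DE]]]; have unb := generic_unbounded gE.
have [n nlarge An] := unb (maxn lo k.+1); exists n => b.
have [v [szv pv vA]] := unbounded_path (n - k.+1) n unb.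
have [y [Ay vy yE]] := gE (last n v).+1 (fun=> b).
have [w [szw pw wA]] := unbounded_path k y unb.
have pu : path ltn n (rcons v y ++ w).
  by rewrite cat_path rcons_path last_rcons pv pw !andbT.
have uA x : x \in n :: (rcons v y ++ w) -> A x.
  rewrite inE mem_cat mem_rcons inE -!orbA.
  by case/or4P => [/eqP->|/eqP->|/vA|/wA].
exists (rcons v y ++ w); split=> //.
  by rewrite size_cat size_rcons szv szw; lia.
have le_n x : x \in n :: (rcons v y ++ w) -> n <= x.
  rewrite inE => /predU1P[->//|xu]; apply: ltnW.
  by have /allP := order_path_min ltn_trans pu; exact.
rewrite -cat_cons -rcons_cons DE //.
- have lo_le x : x \in n :: v -> lo <= x.
    move=> xv; apply: leq_trans (le_n x _); first by lia.
    move: xv; rewrite !inE mem_cat mem_rcons inE => /predU1P[->|->].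
      by rewrite eqxx.
    by rewrite !orbT.
  apply: yE; move: (pv : sorted ltn (n :: v)) lo_le.
  rewrite lastI sorted_rcons_ltn incr_in_rcons => /andP[-> /allP lt] lo_le.
  rewrite lo_le ?mem_rcons ?mem_head // leqnn /= andbT; apply/allP => x xb.
  by rewrite lt // lo_le // mem_rcons inE xb orbT.
- by move=> x xu; split; [exact: uA | have := le_n x xu; lia].
Qed.

(** * Tame subsets, by iterated limits along an ultrafilter *)
Section Tower.
Variables (D : seq nat -> bool) (p : set (set nat)).
Hypothesis pU : UltraFilter p.

Fixpoint iterated_limit j : seq nat -> bool :=
  if j is i.+1 then fun t => `[< p [set y | iterated_limit i (rcons t y)] >] else D.

Lemma iterated_limitP j t :
  p [set y | iterated_limit j (rcons t y) = iterated_limit j.+1 t].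
Proof.
rewrite /=; case: asboolP => [//|np].
have [//|] := in_ultra_setVsetC [set y | iterated_limit j (rcons t y)] pU.
by apply: filterS => y /= /negP/negbTE.
Qed.

Lemma filter_forall_seq (T : eqType) (P : T -> set nat) (l : seq T) :
  (forall t, p (P t)) -> p [set y | forall t, t \in l -> P t y].
Proof.
move=> pP; elim: l => [|t l IH]; first by apply: filterS filterT => y _ t.
apply: filterS (filterI (pP t) IH) => y [Pty Ply] t'.
by rewrite inE => /predU1P[->|/Ply].
Qed.

Lemma iterated_limit_uniform m : p [set y | forall j t, j <= m -> incr_in 0 m t ->
  iterated_limit j (rcons t y) = iterated_limit j.+1 t].
Proof.
have [ss ssP] := sorted_below_enum m.
pose P (q : nat * seq nat) :=
  [set y | iterated_limit q.1 (rcons q.2 y) = iterated_limit q.1.+1 q.2].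
apply: filterS (@filter_forall_seq _ P (allpairs pair (iota 0 m.+1) ss) _).
  move=> y yP j t jm /and3P[_ st rg]; apply: (yP (j, t)).
  by apply: allpairs_f; [rewrite mem_iota; lia | apply: ssP].
by move=> [j t]; exact: iterated_limitP.
Qed.

End Tower.

(** Enumerate [B] so fast that each entry [y] belongs to the sets of the
    ultrafilter given by [iterated_limit_uniform] for all lists formed by its
    predecessors.  Removing the last entries of [n :: u] one by one then raises
    the order of the iterated limit by one at a time, up to [size u = n]; the
    order stays below the entries that are left because these are at least
    [n]. *)
Lemma tame_subset (D : seq nat -> bool) (A : set nat) : (forall n, exists2 y, n <= y & A y) ->
  exists B, [/\ B `<=` A, forall n, exists2 y, n <= y & B y
    & forall n, exists b, forall u, size u = n -> path ltn n u ->
        (forall x, x \in n :: u -> B x) -> D (n :: u) = b].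
Proof.
move=> unb; pose tail n := A `&` [set y | n <= y].
have tailF : ProperFilter (filter_from setT tail).
  apply: filter_from_proper; last first.
    by move=> n _; have [y ny Ay] := unb n; exists y.
  apply: filter_fromT_filter; first by exists 0.
  by move=> i j; exists (maxn i j) => y [Ay /= hy]; split; split=> //=; lia.
have [p [pU tailp]] := ultraFilterLemma tailF.
pose L := iterated_limit D p.
pose P (i m y : nat) := A y /\
  forall j t, j <= m -> incr_in 0 m t -> L j (rcons t y) = L j.+1 t.
have /increasing_choice[g [gmono gP]] i m : exists2 y, m <= y & P i m y.
  have ptail : p (tail m) by apply: tailp; exists m.
  have [y [[Ay my] yL]] := filter_ex (filterI ptail (iterated_limit_uniform D pU m)).
  by exists y.
have gi i : i <= g i by elim: i => // i IH; exact: leq_ltn_trans IH (gmono i _ _).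
have gind i j : g i < g j -> i < j.
  by rewrite (leqW_mono (leq_mono gmono)).
exists (range g); split.
- by move=> _ [i _ <-]; have [m [_ _ []]] := gP i.
- by move=> n; exists (g n); last by exists n.
move=> n; exists (L n [:: n]) => u.
suff gen v w j : v != [::] -> sorted ltn (v ++ w) ->
    (forall x, x \in v ++ w -> range g x) -> j + size w <= head 0 v ->
    L j (v ++ w) = L (j + size w) v.
  move=> sz pu uB; rewrite -[n in L n]sz -(gen [:: n] u 0) //.
  by rewrite add0n sz.
elim/last_ind: w j => [|w y IH] j v0; first by rewrite cats0 addn0.
rewrite -rcons_cat sorted_rcons_ltn size_rcons addnS -addSn => /andP[st /allP lt] inB hj.
rewrite -IH //; last by move=> x xvw; apply: inB; rewrite mem_rcons inE xvw orbT.
have [|i _ yi] := inB y; first by rewrite mem_rcons mem_head.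
subst y.
have [m [_ lm [_ LE]]] := gP i.
have ltm x : x \in v ++ w -> x < m.
  move=> xvw; have [|l _ xl] := inB x; first by rewrite mem_rcons inE xvw orbT.
  by have := lt x xvw; rewrite -xl => /gind/lm.
have hv : head 0 v \in v ++ w by case: (v) v0 => // x v' _; exact: mem_head.
apply: LE; first by have := ltm _ hv; lia.
apply/and3P; split=> //; last by apply/allP => x /ltm.
by case: (v) v0.
Qed.

(** * Infinite sets, pairs and initial segments *)
Lemma infinite_unbounded (A : set nat) :
  infinite_set A <-> forall n, exists2 y, n <= y & A y.
Proof.
split=> [Ainf n|unb /finite_seqP[s As]].
  apply: contra_notP Ainf => no; apply: (sub_finite_set _ (finite_II n)).
  by move=> y Ay /=; rewrite ltnNge; apply/negP => ny; apply: no; exists y.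
have [y sy Ay] := unb (\max_(x <- s) x).+1.
have ys : y \in s by move: Ay; rewrite As.
by have := leq_bigmax_seq (P := xpredT) (F := fun x => x) y ys isT; lia.
Qed.

Lemma two_subsetsP (X s : set nat) : two_subsets X s ->
  exists x y, [/\ X x, X y, x < y & s = [set x; y]].
Proof.
move=> [sX]; rewrite card_eq_sym => /card_set_bijP[f [fs finj fsurj]].
have f0 : s (f 0) by apply: fs.
have f1 : s (f 1) by apply: fs.
have sE : s = [set f 0; f 1].
  apply/seteqP; split=> [z /fsurj[[|[|//]] _ <-]|z [->|->]] //; by [left|right].
have [||f01] := ltngtP (f 0) (f 1).
- by exists (f 0), (f 1); split=> //; apply: sX.
- by exists (f 1), (f 0); split=> //; [apply: sX..|rewrite setUC].
- have : 0 = 1 :> nat by apply: finj => //; rewrite inE.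
  by [].
Qed.

Lemma initial_segment_eq (C : set nat) u w :
  sorted ltn u -> sorted ltn w -> size u = size w ->
  initial_segment [set` u] C -> initial_segment [set` w] C -> u = w.
Proof.
move=> su sw szuw [uC uinit] [wC winit].
have uu := sorted_uniq ltn_trans ltnn su; have uw := sorted_uniq ltn_trans ltnn sw.
suff uwE : u =i w by exact: (irr_sorted_eq ltn_trans ltnn su sw).
have [sub|/existsNP[x /not_implyP[xu xw]]] := pselect (forall x, x \in u -> x \in w).
  by have [_ ] := uniq_min_size uu sub (eq_leq (esym szuw)).
have sub : {subset w <= u}.
  move=> y yw; have [yx|xy|-> //] := ltngtP y x.
    by apply: (uinit y x) => //; exact: wC.
  by case: xw; apply: (winit x y) => //; exact: uC.
by move=> z; have [_ ->] := uniq_min_size uw sub (eq_leq szuw).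
Qed.

(** * The ideal *)
Definition shift_ideal (D : seq nat -> bool) : set (set nat) :=
  [set X | forall k A, shifted D k A -> ~ A `<=` X].

Lemma shifted_infinite D k A : shifted D k A -> infinite_set A.
Proof. by move=> [lo [E [/generic_unbounded/infinite_unbounded]]]. Qed.

Lemma not_shift_ideal D X : ~ shift_ideal D X ->
  exists k A, shifted D k A /\ A `<=` X.
Proof.
by move=> /existsNP[k /existsNP[A /not_implyP[sA /contrapT AX]]]; exists k, A.
Qed.

Lemma shifted_positive D k A X : shifted D k A -> A `<=` X ->
  positive (shift_ideal D) X.
Proof.
move=> sA AX; split; last by move=> /(_ k A sA).
exact: sub_infinite_set AX (shifted_infinite sA).
Qed.

Lemma shift_ideal_is_ideal D : generic setT 0 D -> is_ideal (shift_ideal D).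
Proof.
move=> gD; have sT : shifted D 0 setT.
  exists 0, D; split=> // t ys _ _ _ /size0nil ->; by rewrite cats0.
split.
- by move=> A fA k B /shifted_infinite iB BA; apply/iB/(sub_finite_set BA).
- by move=> /(_ _ _ sT); apply.
- by move=> A B AB IB k C sC CA; apply: (IB k C sC); exact: subset_trans AB.
move=> A B IA IB k C sC CAB.
(* A homogeneous set for this colouring lies in [A] or misses it: each of its
   points is the smaller point of a pair, the set being infinite. *)
have [H [b [sH HC hom]]] := shifted_homogeneous (fun x _ => `[< A x >]) sC.
have Hinf := (infinite_unbounded H).1 (shifted_infinite sH).
have HA x : H x -> `[< A x >] = b.
  by move=> Hx; have [y xy Hy] := Hinf x.+1; exact: hom Hx Hy xy.
case: b {hom} HA => HA; first by apply: (IA _ H sH) => x /HA/asboolP.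
by apply: (IB _ H sH) => x Hx; case: (CAB x (HC x Hx)) => // /asboolP; rewrite HA.
Qed.

Lemma shift_ideal_ramsey D : ramsey (shift_ideal D).
Proof.
move=> X c [_ /not_shift_ideal[k [A [sA AX]]]].
have [H [b [sH HA hom]]] := shifted_homogeneous (fun x y => c [set x; y]) sA.
exists H; split; [exact: shifted_positive sH _ | exact: subset_trans AX |].
by exists b => s /two_subsetsP[x [y [Hx Hy xy ->]]]; exact: hom.
Qed.

Lemma shift_ideal_tall D : tall (shift_ideal D).
Proof.
move=> X [/infinite_unbounded/(tame_subset D)[B [BX Bunb tame]] _].
exists B; first by split=> //; exact/infinite_unbounded.
move=> k A /shifted_two_colours[n two] AB.
have [b bP] := tame n; have [u [szu pu uA]] := two (~~ b).
by rewrite (bP u) // => [|x /uA/AB //]; case: (b).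
Qed.

Definition diagonal_family (D : seq nat -> bool) : set (set nat) :=
  [set s | exists n u, [/\ size u = n, path ltn n u, D (n :: u) & s = [set` n :: u]]].

Lemma shift_ideal_not_galvin D : generic setT 0 D -> ~ galvin (shift_ideal D).
Proof.
move=> gD; have [_ nT _ _] := shift_ideal_is_ideal gD.
move=> /(_ (diagonal_family D) setT) [].
- by move=> _ [n [u [_ _ _ ->]]]; split=> //; exact: finite_seq.
- by split=> //; exact: infinite_nat.
move=> X [[_ /not_shift_ideal[k [A [sA AX]]]] _ [_ homX]].
have [n two] := shifted_two_colours sA.
case: homX => [initX|disj]; last first.
  have [u [szu pu uA Du]] := two true.
  suff : set0 [set` n :: u] by [].
  rewrite -disj; split; last by exists n, u.
  by split; [move=> x /uA/AX | exact: finite_seq].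
have [w [szw pw wA Dw]] := two false.
have Aunb := (infinite_unbounded A).1 (shifted_infinite sA).
(* A list of the wrong colour, prolonged by all later points: the only initial
   segment of [C] of size [n + 1] is [n :: w], which is not in the family. *)
pose C := [set x | x \in n :: w \/ A x /\ last n w < x].
have wmax x : x \in n :: w -> x <= last n w.
  move: (pw : sorted ltn (n :: w)); rewrite lastI sorted_rcons_ltn => /andP[_ /allP lt].
  by rewrite mem_rcons inE => /predU1P[->//|/lt/ltnW].
have wC : initial_segment [set` n :: w] C.
  split=> [x xw|m x xw [//|[_ lm]] mx]; first by left.
  by have := wmax x xw; lia.
have [|_ [m [u [szu pu Du ->]]] uC] := initX C; first split.
- by move=> x [/wA/AX|[/AX]].
- apply/infinite_unbounded => N; have [y Ny Ay] := Aunb (maxn N (last n w).+1).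
  by exists y; [lia | right; split=> //; lia].
have nmin x : C x -> n <= x.
  move=> [|[_]]; last by have := wmax n (mem_head _ _); lia.
  rewrite inE => /predU1P[->//|xw]; apply: ltnW.
  by have /allP := order_path_min ltn_trans pw; exact.
have mn : m = n.
  have nm := nmin m (uC.1 m (mem_head _ _)).
  apply/eqP; rewrite eqn_leq nm andbT leqNgt; apply/negP => lnm.
  have : n \in m :: u by apply: (uC.2 n m) => //; [exact: mem_head | left; exact: mem_head].
  rewrite inE ltn_eqF //= => nu.
  by have /allP/(_ n nu) := order_path_min ltn_trans pu; rewrite /=; lia.
move: Du Dw; rewrite mn in pu szu uC *.
by rewrite (@initial_segment_eq C (n :: u) (n :: w)) /= ?szu ?szw // => ->.
Qed.

Theorem theorem4p16 :
  exists I : set (set nat), [/\ is_ideal I, tall I, ramsey I & ~ galvin I].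
Proof.
have [D gD] := generic_exists; exists (shift_ideal D); split.
- exact: shift_ideal_is_ideal.
- exact: shift_ideal_tall.
- exact: shift_ideal_ramsey.
- exact: shift_ideal_not_galvin.
Qed.
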